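(* Consider a reversible Markov decision problem (RMDP) defined by transition probability matrices $(P(u) : u \in \mathcal{U})$ on $\mathcal{X}$, $P(u) = [p_{ij}(u)]$, and a reward function $r : \mathcal{X} \times \mathcal{U} \to \mathbb{R}$. Let $G = (\mathcal{X},\mathcal{E})$ be its canonical graph, and in the block graph structure of $G$ let $\mathcal{A}$ denote the set of articulation points and $\mathcal{B}$ the set of blocks. Then there exist: (i) for each $B \in \mathcal{B}$, an irreducible reversible transition probability matrix $P^{(0)}(B) = [p^{(0)}_{ij}(B)]$ on $B$ with $p^{(0)}_{ii}(B) = 0$ for all $i \in B$; (ii) for each articulation point $a \in \mathcal{A}$ (if any) and each $u \in \mathcal{U}$, strictly positive numbers $(\nu_a(u,B) : B \in \mathcal{B}, B \ni a)$ satisfying $\sum_{B \ni a} \nu_a(u,B) = 1$; (iii) a function $\rho : \mathcal{X} \times \mathcal{U} \to (0,1]$; such that, setting $\nu_i(u,B) := 1$ for all $u \in \mathcal{U}$, $B \in \mathcal{B}$ and $i \in \mathring{B}$, for each $u \in \mathcal{U}$ the entries of $P(u)$ are given by $$p_{ij}(u) = \rho(i,u)\,\nu_i(u,B)\,p^{(0)}_{ij}(B) \quad \text{if } i \in B,\ j \in B,\ j \neq i,\ B \in \mathcal{B},$$ $$p_{ii}(u) = 1 - \rho(i,u) \quad \text{if } i \in \mathcal{X},$$ $$p_{ij}(u) = 0 \quad \text{otherwise}.$$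
   Context: $\mathcal{X}$ (states) and $\mathcal{U}$ (actions) are finite sets, each of cardinality at least $2$. For each $u \in \mathcal{U}$, $P(u) = [p_{ij}(u)]$ is a transition probability matrix (row-stochastic matrix) on $\mathcal{X}$, and $r : \mathcal{X} \times \mathcal{U} \to \mathbb{R}$ is a reward function. A stationary randomized Markov strategy $\mu$ is a choice, for each $i \in \mathcal{X}$, of a probability distribution $(\mu(u|i) : u \in \mathcal{U})$ on $\mathcal{U}$; $\mathcal{M}$ is the set of all such strategies. For $\mu \in \mathcal{M}$, $P(\mu) = [p_{ij}(\mu)]$ with $p_{ij}(\mu) := \sum_u p_{ij}(u)\mu(u|i)$. An irreducible transition probability matrix $P=[p_{ij}]$ with stationary distribution $(\pi_i)$ is reversible if $\pi_i p_{ij} = \pi_j p_{ji}$ for all $i,j$. The data form a reversible Markov decision problem (RMDP) if $P(\mu)$ is irreducible and reversible for every $\mu \in \mathcal{M}$. The canonical graph of an RMDP is the simple connected undirected graph $G = (\mathcal{X},\mathcal{E})$ (no multiple edges, no self-loops) such that for all $u \in \mathcal{U}$ and all distinct $i,j \in \mathcal{X}$, $p_{ij}(u) > 0$ if and only if $(i,j) \in \mathcal{E}$ (such a graph exists for every RMDP and is clearly unique). Block graph structure of a simple connected graph $G$: a cutvertex is a vertex whose removal, together with the edges connected to it, leaves a disconnected graph. A block is a maximal connected subgraph of $G$ that (as a graph in its own right) has no cutvertices. Two distinct blocks that intersect do so at a single vertex; such a vertex is called an articulation point. (Thus each articulation point lies in at least two blocks; if there is only one block there are no articulation points.) $\mathcal{A}$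 is the set of articulation points, $\mathcal{B}$ the set of blocks; $B$ also denotes the vertex set of the block $B$, and $\mathring{B}$ denotes the set of vertices of $B$ that are not articulation points. *)

(* Defs.v *)
From mathcomp Require Import all_boot all_order all_algebra.
Set Implicit Arguments.
Unset Strict Implicit.
Unset Printing Implicit Defensive.
Import Order.TTheory GRing.Theory Num.Theory.
Local Open Scope ring_scope.

(* MathComp matrices are indexed by ordinals; here a matrix on a finite set T
   is a function T -> T -> R, so that T may be the state space or the vertex
   set of a block. *)
Section Chains.
Variables (R : realFieldType) (T : finType).

Definition distribution (f : T -> R) : Prop :=
  (forall x, 0 <= f x) /\ \sum_x f x = 1.

Definition stochastic (P : T -> T -> R) : Prop :=
  forall i, distribution (P i).

Fixpoint nstep (P : T -> T -> R) (n : nat) (i j : T) : R :=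
  if n is m.+1 then \sum_k P i k * nstep P m k j else (i == j)%:R.

Definition irreducible (P : T -> T -> R) : Prop :=
  forall i j, exists n, 0 < nstep P n i j.

Definition stationary (P : T -> T -> R) (pi : T -> R) : Prop :=
  distribution pi /\ forall j, \sum_i pi i * P i j = pi j.

(* Meant for irreducible P, whose stationary distribution is unique. *)
Definition reversible (P : T -> T -> R) : Prop :=
  exists pi, stationary P pi /\ forall i j, pi i * P i j = pi j * P j i.

End Chains.

(* p u i j is the probability of moving from i to j under action u, and
   mu i u is the probability of choosing u in state i. *)
Section DecisionProblems.
Variables (R : realFieldType) (X U : finType).

Definition strategy (mu : X -> U -> R) : Prop :=
  forall i, distribution (mu i).

Definition strategy_matrix (p : U -> X -> X -> R) (mu : X -> U -> R) :
    X -> X -> R :=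
  fun i j => \sum_u p u i j * mu i u.

Definition rmdp (p : U -> X -> X -> R) : Prop :=
  (forall u, stochastic (p u)) /\
  (forall mu, strategy mu ->
     irreducible (strategy_matrix p mu) /\ reversible (strategy_matrix p mu)).

End DecisionProblems.

(* A graph is a vertex set together with a set of edges, an edge being an
   unordered pair of vertices; simple_graph is the well-formedness condition. *)
Definition graph (X : finType) : Type := ({set X} * {set {set X}})%type.

Section Graphs.
Variable X : finType.
Implicit Types (G H B : graph X) (x y v a : X).

Definition verts H : {set X} := H.1.
Definition edges H : {set {set X}} := H.2.

Definition simple_graph H : bool :=
  [forall e in edges H, (e \subset verts H) && (#|e| == 2)].

Definition adj H : rel X := fun x y => [set x; y] \in edges H.

(* The empty graph counts as connected, so that a graph with a single vertex
   has no cutvertex. *)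
Definition connected H : bool :=
  [forall x in verts H, forall y in verts H, connect (adj H) x y].

Definition remove_vertex H v : graph X :=
  (verts H :\ v, [set e in edges H | v \notin e]).

Definition cutvertex H v : bool :=
  (v \in verts H) && ~~ connected (remove_vertex H v).

Definition subgraph H G : bool :=
  [&& simple_graph H, verts H \subset verts G & edges H \subset edges G].

Definition connected_nocut H G : bool :=
  [&& subgraph H G, connected H & [forall v, ~~ cutvertex H v]].

Definition block G B : bool :=
  connected_nocut B G &&
  [forall H, connected_nocut H G && subgraph B H ==> (H == B)].

Definition articulation G a : bool :=
  [exists B1, exists B2,
    [&& block G B1, block G B2, B1 != B2 & a \in verts B1 :&: verts B2]].

Definition interior G B : {set X} :=
  [set i in verts B | ~~ articulation G i].

End Graphs.

Definition canonical_graph (R : realFieldType) (X U : finType)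
    (p : U -> X -> X -> R) (G : graph X) : Prop :=
  [/\ simple_graph G, verts G = [set: X], connected G &
      forall u i j, i != j -> (0 < p u i j <-> adj G i j)].

(* Main.v *)
Require Import Defs.
From mathcomp Require Import all_boot all_order all_algebra.
From mathcomp Require Import reals ring.
Set Implicit Arguments.
Unset Strict Implicit.
Unset Printing Implicit Defensive.
Import Order.TTheory GRing.Theory Num.Theory.
Local Open Scope ring_scope.

(** Write block_exit u i B for the probability that action u moves i to another
    vertex of the block B. Everything rests on one fact: given that such a move
    happens, the law of its endpoint does not depend on u
    (block_jump_action_indep). Then p^(0)(B) can be read off from any fixed
    action u0, as the chain of jumps inside B, and the action only decides how
    the total probability 1 - p_ii(u) of leaving i is shared between the blocks
    through i: this gives rho(i,u) = 1 - p_ii(u) and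
    nu_i(u,B) = block_exit u i B / rho(i,u).

    The fact is proved by comparing two deterministic policies that differ only
    at i, where one takes u and the other v. Both induced chains are reversible,
    with positive stationary distributions pi and qi. Away from i the transition
    probabilities agree, so detailed balance makes pi / qi constant along every
    path avoiding i; since i is not a cutvertex of B, the ratio has one value on
    B minus i. Detailed balance between i and j in B then says that
    p_ij(u) is p_ij(v) times that value times qi_i / pi_i, a factor that does
    not depend on j (block_transition_proportional).

    On the graph side, two adjacent vertices lie in exactly one common block:
    an edge has no cutvertex, hence extends to a block (adj_common_block), and
    two blocks sharing two vertices coincide because their union has no
    cutvertex (block_eq). Therefore the numbers block_exit u i B, over the
    blocks B through i, add up to 1 - p_ii(u) (sum_block_exit), which makes the
    nu_i(u,B) sum to 1; at a vertex of a single block this says that nu is 1. *)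

Lemma connect_invariant (T : finType) (e : rel T) (Q : T -> Prop) (x y : T) :
  (forall a b, e a b -> Q a -> Q b) -> connect e x y -> Q x -> Q y.
Proof.
move=> eQ /connectP[s]; elim: s x => [|z s IHs] x /=; first by move=> _ ->.
by move=> /andP[exz zs] yE Qx; apply: (IHs z) => //; exact: eQ exz Qx.
Qed.

(** * Blocks of a graph *)

Section Blocks.
Variable X : finType.
Implicit Types (G H B : graph X) (x y i j k v : X).

Lemma adjC H x y : adj H x y = adj H y x.
Proof. by rewrite /adj setUC. Qed.

Lemma adj_simple H x y :
  simple_graph H -> adj H x y -> [/\ x \in verts H, y \in verts H & x != y].
Proof.
move=> /forall_inP sH /sH /andP[/subsetP sub /eqP c2].
split; try by apply: sub; rewrite !inE eqxx ?orbT.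
by apply: contra_eqN c2 => /eqP ->; rewrite setUid cards1.
Qed.

Lemma subgraph_adj H G x y : subgraph H G -> adj H x y -> adj G x y.
Proof. by case/and3P=> _ _ /subsetP; apply. Qed.

Lemma connected_has_neighbor H i :
  simple_graph H -> connected H -> i \in verts H -> (1 < #|verts H|)%N ->
  exists2 k, k \in verts H & adj H i k.
Proof.
move=> sH cH iH /card_gt1P[x [y [xH yH xy]]].
have [j jH ij] : exists2 j, j \in verts H & i != j.
  by case: (eqVneq i x) xy => [<-|ix] xy; [exists y | exists x].
move/forall_inP/(_ i iH)/forall_inP/(_ j jH)/connectP: cH => [[|k s] /=].
  by move=> _ ji; rewrite ji eqxx in ij.
by move=> /andP[ik _] _; exists k => //; have [] := adj_simple sH ik.
Qed.

Definition graph_union H1 H2 : graph X :=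
  (verts H1 :|: verts H2, edges H1 :|: edges H2).

Lemma remove_vertex_union H1 H2 v :
  remove_vertex (graph_union H1 H2) v =
  graph_union (remove_vertex H1 v) (remove_vertex H2 v).
Proof.
rewrite /remove_vertex /graph_union /=; congr (_, _); first exact: setDUl.
by apply/setP=> e; rewrite !inE andb_orl.
Qed.

Lemma connected_union H1 H2 x :
  connected H1 -> connected H2 -> x \in verts H1 -> x \in verts H2 ->
  connected (graph_union H1 H2).
Proof.
move=> c1 c2 x1 x2; have adjU a b :
    adj (graph_union H1 H2) a b = adj H1 a b || adj H2 a b.
  by rewrite /adj /= inE.
have toX a : a \in verts H1 :|: verts H2 -> connect (adj (graph_union H1 H2)) a x.
  rewrite inE => /orP[aH|aH].
    have := forall_inP (forall_inP c1 a aH) x x1; apply: connect_sub => b c bc.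
    by apply: connect1; rewrite adjU bc.
  have := forall_inP (forall_inP c2 a aH) x x2; apply: connect_sub => b c bc.
  by apply: connect1; rewrite adjU bc orbT.
have symU : connect_sym (adj (graph_union H1 H2)).
  by apply: sym_connect_sym => a b; exact: adjC.
apply/forall_inP=> a aU; apply/forall_inP=> b bU.
by apply: connect_trans (toX a aU) _; rewrite symU; exact: toX.
Qed.

(** A vertex outside H is covered as well: its removal leaves H unchanged. *)
Lemma nocut_connected_remove H G v :
  connected_nocut H G -> connected (remove_vertex H v).
Proof.
case/and3P=> /and3P[sH _ _] cH /forallP/(_ v); rewrite negb_and negbK.
case/orP=> // vH; suff -> : remove_vertex H v = H by [].
case: H sH cH vH => V E sH cH vH; rewrite /remove_vertex /=; congr (_, _).
  apply/setP=> x; rewrite !inE; case: eqP => //= ->.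
  by apply/esym/negbTE.
apply/setP=> e; rewrite inE andb_idr // => eE.
by case/andP: (forall_inP sH e eE) => /subsetP sub _; apply: contra vH => /sub.
Qed.

(** Deleting a vertex leaves both parts connected, and at least one of the two
    shared vertices survives to link them. *)
Lemma connected_nocut_union G H1 H2 i j :
  connected_nocut H1 G -> connected_nocut H2 G -> i != j ->
  i \in verts H1 :&: verts H2 -> j \in verts H1 :&: verts H2 ->
  connected_nocut (graph_union H1 H2) G.
Proof.
move=> n1 n2 ij; rewrite !inE => /andP[i1 i2] /andP[j1 j2].
have [/and3P[/and3P[s1 V1 E1] c1 _] /and3P[/and3P[s2 V2 E2] c2 _]] := (n1, n2).
apply/and3P; split.
- apply/and3P; split; last 2 first.
  + by rewrite /= subUset; apply/andP.
  + by rewrite /= subUset; apply/andP.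
  apply/forall_inP=> e /setUP[eE|eE].
    case/andP: (forall_inP s1 e eE) => eV ->; rewrite andbT.
    exact: subset_trans eV (subsetUl _ _).
  case/andP: (forall_inP s2 e eE) => eV ->; rewrite andbT.
  exact: subset_trans eV (subsetUr _ _).
- exact: connected_union c1 c2 i1 i2.
- apply/forallP=> v; rewrite negb_and negbK remove_vertex_union; apply/orP; right.
  have [k [kv k1 k2]] : exists k, [/\ k != v, k \in verts H1 & k \in verts H2].
    by case: (eqVneq i v) ij => [<-|iv] ij; [exists j; rewrite eq_sym | exists i].
  apply: (@connected_union _ _ k); try exact: (@nocut_connected_remove _ G).
    by rewrite !inE kv.
  by rewrite !inE kv.
Qed.

Definition edge_graph i j : graph X := ([set i; j], [set [set i; j]]).

Lemma connected_nocut_edge_graph G i j :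
  simple_graph G -> adj G i j -> connected_nocut (edge_graph i j) G.
Proof.
move=> sG ij; have [iG jG neq_ij] := adj_simple sG ij.
apply/and3P; split.
- apply/and3P; split=> /=; last by rewrite sub1set.
  + by apply/forall_inP=> e /set1P ->; rewrite subxx cards2 neq_ij.
  + by rewrite subUset !sub1set iG.
- have e1 : adj (edge_graph i j) i j by rewrite /adj inE.
  have e2 : adj (edge_graph i j) j i by rewrite adjC.
  apply/forall_inP=> x /set2P[] ->; apply/forall_inP=> y /set2P[] ->;
    by [exact: connect0 | exact: connect1].
- apply/forallP=> v; rewrite negb_and negbK -implybE; apply/implyP=> vij.
  (* after the removal only one vertex remains *)
  apply/forall_inP=> x xV; apply/forall_inP=> y yV.
  suff -> : x = y by exact: connect0.
  move: vij xV yV; rewrite !inE.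
  case/orP=> /eqP-> /andP[/negbTE xv xij] /andP[/negbTE yv yij];
    by move: xij yij; rewrite xv yv ?orbF => /eqP-> /eqP->.
Qed.

Lemma subgraph_trans H1 H2 H3 :
  subgraph H1 H2 -> subgraph H2 H3 -> subgraph H1 H3.
Proof.
case/and3P=> s1 V12 E12 /and3P[_ V23 E23].
by rewrite /subgraph s1 (subset_trans V12 V23) (subset_trans E12 E23).
Qed.

(** Among the connected subgraphs without cutvertices that contain H, one with
    the largest number of vertices plus edges is maximal for inclusion. *)
Lemma block_extending G H :
  connected_nocut H G -> exists2 B, block G B & subgraph H B.
Proof.
move=> nH; pose Q B := connected_nocut B G && subgraph H B.
have QH : Q H.
  by rewrite /Q nH; case/and3P: (nH) => /and3P[sH _ _] _ _; rewrite /subgraph sH !subxx.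
case: (@arg_maxnP _ (H : {set X} * {set {set X}}) Q
        (fun B => #|verts B| + #|edges B|)%N QH) => B /andP[nB HB] maxB.
exists B => //; rewrite /block nB; apply/forallP=> K.
apply/implyP=> /andP[nK BK].
have := maxB K; rewrite /Q nK (subgraph_trans HB BK) => /(_ isT) leKB.
case/and3P: BK => _ VBK EBK.
have leV := subset_leq_card VBK; have leE := subset_leq_card EBK.
have EV : verts B = verts K.
  apply/eqP; rewrite eqEcard VBK -(leq_add2r #|edges B|).
  by rewrite (leq_trans _ leKB) // leq_add2l.
have EE : edges B = edges K.
  apply/eqP; rewrite eqEcard EBK -(leq_add2l #|verts B|).
  by rewrite (leq_trans _ leKB) // leq_add2r.
by apply/eqP; exact: injective_projections.
Qed.

Lemma block_maximal G B H :
  block G B -> connected_nocut H G -> subgraph B H -> H = B.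
Proof. by case/andP=> _ /forallP/(_ H) + nH BH; rewrite nH BH => /eqP. Qed.

Lemma block_subgraph G B : block G B -> subgraph B G.
Proof. by case/andP=> /and3P[]. Qed.

Lemma adj_common_block G i j :
  simple_graph G -> adj G i j ->
  exists B, [/\ block G B, i \in verts B & j \in verts B].
Proof.
move=> sG /(connected_nocut_edge_graph sG)/block_extending[B bB].
case/and3P=> _ /subsetP sub _.
by exists B; split=> //; apply: sub; rewrite !inE eqxx ?orbT.
Qed.

(** Otherwise the union of the two blocks would be a larger subgraph without
    cutvertices. *)
Lemma block_eq G B1 B2 i j :
  block G B1 -> block G B2 -> i != j ->
  i \in verts B1 -> j \in verts B1 -> i \in verts B2 -> j \in verts B2 ->
  B1 = B2.
Proof.
move=> b1 b2 ij i1 j1 i2 j2.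
have [[n1 _] [n2 _]] := (andP b1, andP b2).
have nU : connected_nocut (graph_union B1 B2) G.
  by apply: (connected_nocut_union n1 n2 ij); rewrite inE ?i1 ?j1.
have [/and3P[s1 _ _] /and3P[s2 _ _]] := (block_subgraph b1, block_subgraph b2).
rewrite -(block_maximal b1 nU); last by rewrite /subgraph s1 /= !subsetUl.
by apply: (block_maximal b2 nU); rewrite /subgraph s2 /= !subsetUr.
Qed.

(** Every vertex of G is an endpoint of an edge, and an edge properly contains
    the empty graph and the graph of either endpoint, so these are not
    maximal. *)
Lemma block_card_gt1 G B :
  simple_graph G -> connected G -> (1 < #|verts G|)%N -> block G B ->
  (1 < #|verts B|)%N.
Proof.
move=> sG cG G2 bB; rewrite ltnNge; apply/negP=> B1.
have /and3P[sB VB _] := block_subgraph bB.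
have [i iG Bi] : exists2 i, i \in verts G & verts B \subset [set i].
  have [B0|[i iB]] := set_0Vmem (verts B).
    by case/card_gt1P: G2 => i [_ [iG _ _]]; exists i; rewrite // B0 sub0set.
  exists i; first exact: (subsetP VB).
  by apply/subsetP=> x xB; rewrite inE (card_le1_eqP B1 i x).
have [k _ ik] := connected_has_neighbor sG cG iG G2.
suff BE : edge_graph i k = B.
  by move: B1; rewrite -BE /= cards2; have [_ _ ->] := adj_simple sG ik.
apply: (block_maximal bB); first exact: connected_nocut_edge_graph.
rewrite /subgraph sB (subset_trans Bi) ?subsetUl //=.
apply/subsetP=> e eB; case/andP: (forall_inP sB e eB) => eV /eqP c2.
by have := subset_leq_card (subset_trans eV Bi); rewrite c2 cards1.
Qed.

Lemma interior_single_block G B B' i :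
  block G B -> i \in interior G B -> block G B' -> i \in verts B' -> B' = B.
Proof.
move=> bB; rewrite inE => /andP[iB /existsPn/(_ B')/existsPn/(_ B) notA] bB' iB'.
by apply/eqP; move: notA; rewrite bB bB' inE iB iB' /= andbT negbK.
Qed.

Lemma connect_adj_sub H (i j : {x : X | x \in verts H}) :
  simple_graph H -> connect (adj H) (val i) (val j) ->
  connect (relpre val (adj H)) i j.
Proof.
move=> sH /connectP[s]; elim: s i => [|z s IHs] i /=.
  by move=> _ /val_inj ->; exact: connect0.
case/andP=> iz zs jE; have [_ zH _] := adj_simple sH iz.
apply: (@connect_trans _ _ (exist _ z zH)); first exact: connect1.
exact: IHs.
Qed.

End Blocks.

(** * Finite chains *)

Section Chains.
Variable R : realFieldType.

Lemma psumr_gt0 (I : finType) (Q : pred I) (F : I -> R) (k : I) :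
  (forall i, Q i -> 0 <= F i) -> Q k -> 0 < F k -> 0 < \sum_(i | Q i) F i.
Proof.
move=> F0 Qk Fk; rewrite (bigD1 k) //= ltr_pwDl //.
by apply: sumr_ge0 => i /andP[Qi _]; exact: F0.
Qed.

Variable T : finType.
Implicit Types (P : T -> T -> R) (w : T -> R).

Lemma nstep_ge0 P n i j : (forall a b, 0 <= P a b) -> 0 <= nstep P n i j.
Proof.
move=> P0; elim: n i => [|n IHn] i /=; first exact: ler0n.
by apply: sumr_ge0 => k _; exact: mulr_ge0.
Qed.

Lemma irreducible_of_connect P :
  (forall i j, 0 <= P i j) ->
  (forall i j, connect (fun a b => 0 < P a b) i j) -> irreducible P.
Proof.
move=> P0 cP i j; have /connectP[s] := cP i j.
elim: s i => [|z s IHs] i /= => [_ ->|/andP[iz zs] jE].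
  by exists 0%N; rewrite /= eqxx ltr01.
have [n nzj] := IHs z zs jE; exists n.+1 => /=.
apply: (@psumr_gt0 _ _ _ z) => // [k _|]; last exact: mulr_gt0.
by apply: mulr_ge0; rewrite ?nstep_ge0.
Qed.

(** Detailed balance survives normalisation of w, and summing it over i gives
    stationarity. *)
Lemma reversible_of_weights P w :
  stochastic P -> (forall i, 0 <= w i) -> 0 < \sum_i w i ->
  (forall i j, w i * P i j = w j * P j i) -> reversible P.
Proof.
move=> sP w0 W0 wP; exists (fun i => w i / \sum_k w k).
have bal i j : w i / (\sum_k w k) * P i j = w j / (\sum_k w k) * P j i.
  by rewrite mulrAC wP mulrAC.
split=> //; split; first split.
- by move=> i; rewrite divr_ge0 // ltW.
- by rewrite -mulr_suml divff // gt_eqF.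
- move=> j; under eq_bigr do rewrite bal.
  by rewrite -mulr_sumr (proj2 (sP j)) mulr1.
Qed.

End Chains.

(** * Transition probabilities inside a block *)

Section ReversibleMDP.
Variables (R : realFieldType) (X U : finType) (p : U -> X -> X -> R).
Variable G : graph X.
Hypotheses (hp : rmdp p) (hG : canonical_graph p G) (hX : (2 <= #|X|)%N).
Implicit Types (i j k : X) (u v : U) (B : graph X).

Let p_ge0 u i j : 0 <= p u i j.
Proof. by have [sp _] := hp; have [] := sp u i. Qed.

Let G_simple : simple_graph G. Proof. by case: hG. Qed.
Let G_connected : connected G. Proof. by case: hG. Qed.
Let G_vertsE : verts G = [set: X]. Proof. by case: hG. Qed.
Let G_card : (1 < #|verts G|)%N. Proof. by rewrite G_vertsE cardsT. Qed.

Lemma adj_transition u i j : adj G i j -> 0 < p u i j.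
Proof.
move=> ij; have [_ _ nij] := adj_simple G_simple ij.
by case: hG => _ _ _ /(_ u i j nij)[_]; apply.
Qed.

Lemma nonadj_transition u i j : i != j -> ~~ adj G i j -> p u i j = 0.
Proof.
case: hG => _ _ _ hadj nij /negP nadj; apply/eqP; move: (p_ge0 u i j).
by rewrite le0r => /orP[] // pos; case: nadj; apply/(hadj u).
Qed.

(** The chain in which action f i is taken in state i is reversible, and its
    stationary distribution charges every state because G is connected. *)
Lemma policy_detailed_balance (f : X -> U) :
  exists pi : X -> R, (forall i, 0 < pi i) /\
    forall i j, pi i * p (f i) i j = pi j * p (f j) j i.
Proof.
pose mu i u : R := (u == f i)%:R.
have smu : strategy mu.
  move=> i; split=> [u|]; first exact: ler0n.
  by rewrite (bigD1 (f i)) //= /mu eqxx big1 ?addr0 // => u /negbTE ->.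
have PE i j : strategy_matrix p mu i j = p (f i) i j.
  rewrite /strategy_matrix (bigD1 (f i)) //= /mu eqxx mulr1.
  by rewrite big1 ?addr0 // => u /negbTE ->; rewrite mulr0.
have [_ [pi [[[pi0 pi1] _] bal]]] := proj2 hp mu smu.
have {}bal i j : pi i * p (f i) i j = pi j * p (f j) j i.
  by move: (bal i j); rewrite !PE.
exists pi; split=> // i.
have [x /= pix] : exists x, true && (0 < pi x).
  by apply: psumr_neq0P => //; rewrite pi1; apply/eqP/oner_neq0.
have xi : connect (adj G) x i.
  by apply: (forall_inP (forall_inP G_connected x _)); rewrite G_vertsE inE.
apply: (connect_invariant (Q := fun y => 0 < pi y) _ xi pix) => a b ab pia.
have : 0 < pi b * p (f b) b a by rewrite -bal mulr_gt0 // adj_transition.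
by rewrite pmulr_lgt0 // adj_transition // adjC.
Qed.

Definition block_exit u i B : R := \sum_(k in verts B | k != i) p u i k.

Lemma block_exit_gt0 u i B : block G B -> i \in verts B -> 0 < block_exit u i B.
Proof.
move=> bB iB; have /and3P[sB _ _] := block_subgraph bB.
have /andP[/and3P[_ cB _] _] := bB.
have B2 := block_card_gt1 G_simple G_connected G_card bB.
have [k kB ik] := connected_has_neighbor sB cB iB B2.
apply: (@psumr_gt0 _ _ _ _ k) => //.
  by have [_ _ nik] := adj_simple sB ik; rewrite kB eq_sym.
by apply: adj_transition; apply: subgraph_adj ik; exact: block_subgraph.
Qed.

(** Compare the stationary distributions of the policy that always takes v and
    of the one that deviates to u at i only. Both satisfy the same balance
    equations along edges that avoid i, so their ratio is constant on what
    remains of B after deleting i, which is connected because i is not a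
    cutvertex of B. *)
Lemma block_transition_proportional u v i B :
  block G B -> i \in verts B ->
  exists c, forall j, j \in verts B -> j != i -> p u i j = c * p v i j.
Proof.
move=> bB iB; have /andP[nB _] := bB.
have [k kB ki] : exists2 k, k \in verts B & k != i.
  have := block_card_gt1 G_simple G_connected G_card bB.
  case/card_gt1P=> x [y [xB yB xy]].
  by case: (eqVneq x i) xy => [->|xi] xy; [exists y; rewrite // eq_sym | exists x].
have [pi [pi0 balpi]] := policy_detailed_balance (fun x => if x == i then u else v).
have [qi [qi0 balqi]] := policy_detailed_balance (fun=> v).
have neq0 (f : X -> R) x : (forall y, 0 < f y) -> f x != 0.
  by move=> f0; rewrite gt_eqF.
have ratio j : j \in verts B -> j != i -> pi j / qi j = pi k / qi k.
  move=> jB ji.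
  have kj : connect (adj (remove_vertex B i)) k j.
    apply: (forall_inP (forall_inP (nocut_connected_remove i nB) k _)).
      by rewrite !inE ki.
    by rewrite !inE ji.
  apply: (connect_invariant (Q := fun y => pi y / qi y = pi k / qi k) _ kj) => //.
  move=> a b; rewrite {1}/adj !inE negb_or => /andP[abB /andP[ia ib]] <-.
  have abG : adj G a b by apply: subgraph_adj abB; exact: block_subgraph.
  move: (balpi a b) (balqi a b).
  rewrite !(eq_sym _ i) (negbTE ia) (negbTE ib) => pab qab.
  apply/eqP; rewrite eqr_div ?neq0 //.
  have pv : p v a b * p v b a != 0.
    by rewrite gt_eqF // mulr_gt0 // adj_transition // adjC.
  apply/eqP/(mulIf pv).
  transitivity (pi b * p v b a * (qi a * p v a b)); first by ring.
  by rewrite -pab qab; ring.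
exists (pi k / qi k * (qi i / pi i)) => j jB ji; rewrite -(ratio j jB ji).
move: (balpi i j) (balqi i j); rewrite eqxx (negbTE ji) => pij qij.
(* solve the balance equations between i and j under the two policies: both
   involve p v j i, since both policies take v in j *)
have -> : p u i j = pi j * p v j i / pi i by rewrite -pij mulrAC divff ?mul1r ?neq0.
have -> : p v i j = qi j * p v j i / qi i by rewrite -qij mulrAC divff ?mul1r ?neq0.
by field; rewrite !neq0.
Qed.

Lemma block_jump_action_indep u v i j B :
  block G B -> i \in verts B -> j \in verts B -> j != i ->
  p u i j / block_exit u i B = p v i j / block_exit v i B.
Proof.
move=> bB iB jB ji; have [c cP] := block_transition_proportional u v bB iB.
have exitE : block_exit u i B = c * block_exit v i B.
  by rewrite /block_exit mulr_sumr; apply: eq_bigr => k /andP[]; exact: cP.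
have c0 : c != 0.
  apply/eqP=> cE; have := block_exit_gt0 u bB iB.
  by rewrite exitE cE mul0r ltxx.
by rewrite exitE cP // -mulf_div divff // mul1r.
Qed.

(** Leaving i means moving to some neighbour, and every neighbour of i lies in
    exactly one of the blocks through i. *)
Lemma sum_block_exit u i :
  \sum_(B : graph X | block G B && (i \in verts B)) block_exit u i B =
  1 - p u i i.
Proof.
have -> : 1 - p u i i = \sum_(k | k != i) p u i k.
  have [_ pu1] := proj1 hp u i.
  by rewrite -[in LHS]pu1 (bigD1 i) //= [LHS]addrC addKr.
rewrite /block_exit (exchange_big_dep (fun k => k != i)) /=; last first.
  by move=> B k _ /andP[].
apply: eq_bigr => k ki.
have [ik|nik] := boolP (adj G i k); last first.
  by rewrite nonadj_transition ?big1 // eq_sym.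
have [B [bB iB kB]] := adj_common_block G_simple ik.
apply: (big_pred1 (B : {set X} * {set {set X}})) => B' /=; rewrite ki andbT.
apply/andP/eqP=> [[/andP[bB' iB'] kB']|->]; last by rewrite bB iB kB.
by apply: (block_eq bB' bB ki).
Qed.

Lemma leaving_gt0 u i : 0 < 1 - p u i i.
Proof.
have [k _ ik] : exists2 k, k \in verts G & adj G i k.
  by apply: connected_has_neighbor; rewrite // G_vertsE inE.
have [B [bB iB _]] := adj_common_block G_simple ik.
rewrite -(sum_block_exit u); apply: (@psumr_gt0 _ _ _ _ (B : _ * _)).
- by move=> B' /andP[bB' iB']; exact/ltW/block_exit_gt0.
- by rewrite bB.
- exact: block_exit_gt0.
Qed.

Definition block_jump u B (i j : {x : X | x \in verts B}) : R :=
  if j == i then 0 else p u (val i) (val j) / block_exit u (val i) B.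

Lemma block_jump_stochastic u B : block G B -> stochastic (@block_jump u B).
Proof.
move=> bB i; split=> [j|].
  rewrite /block_jump; case: ifP => // _.
  by rewrite divr_ge0 // ltW // block_exit_gt0 // (valP i).
rewrite (bigD1 i) //= /block_jump eqxx add0r.
under eq_bigr => j /negbTE -> do [].
rewrite -mulr_suml.
have -> : \sum_(j : {x | x \in verts B} | j != i) p u (val i) (val j) =
          block_exit u (val i) B.
  by rewrite /block_exit big_sub_cond.
by rewrite divff // gt_eqF // block_exit_gt0 // (valP i).
Qed.

Lemma block_jump_irreducible u B : block G B -> irreducible (@block_jump u B).
Proof.
move=> bB; have [sjump bBG] := (block_jump_stochastic u bB, block_subgraph bB).
have /and3P[sB _ _] := bBG; have /andP[/and3P[_ cB _] _] := bB.
apply: irreducible_of_connect => [i j|i j]; first by case: (sjump i).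
have := forall_inP (forall_inP cB _ (valP i)) _ (valP j).
move/(connect_adj_sub sB); apply: connect_sub => a b /= ab; apply: connect1.
rewrite /block_jump; case: eqP => [ba|_].
  by have [_ _] := adj_simple sB ab; rewrite ba eqxx.
rewrite divr_gt0 ?block_exit_gt0 ?(valP a) //.
exact/adj_transition/(subgraph_adj bBG).
Qed.

(** If pi is in detailed balance with P(u), then dividing the transitions out of
    i by the probability of jumping inside B is compensated by multiplying
    pi i by that probability. *)
Lemma block_jump_reversible u B : block G B -> reversible (@block_jump u B).
Proof.
move=> bB; have [pi [pi0 bal]] := policy_detailed_balance (fun=> u).
have exit0 (i : {x | x \in verts B}) : 0 < block_exit u (val i) B.
  by rewrite block_exit_gt0 // (valP i).
have w0 (i : {x | x \in verts B}) : 0 < pi (val i) * block_exit u (val i) B.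
  exact: mulr_gt0.
apply: (reversible_of_weights
  (w := fun i : {x | x \in verts B} => pi (val i) * block_exit u (val i) B)).
- exact: block_jump_stochastic.
- by move=> i; exact: ltW.
- have /ltnW := block_card_gt1 G_simple G_connected G_card bB.
  case/card_gt0P=> x xB; apply: (psumr_gt0 (k := exist _ x xB)) => // i _.
  exact: ltW.
move=> i j; rewrite /block_jump [i == j]eq_sym; case: eqP => _; first by rewrite !mulr0.
have eq_out (a b : {x | x \in verts B}) :
    pi (val a) * block_exit u (val a) B *
      (p u (val a) (val b) / block_exit u (val a) B) =
    pi (val a) * p u (val a) (val b).
  by field; rewrite gt_eqF.
by rewrite !eq_out bal.
Qed.

End ReversibleMDP.

Theorem theorem2 (R : realType) (X U : finType)
    (hX : (2 <= #|X|)%N) (hU : (2 <= #|U|)%N)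
    (p : U -> X -> X -> R) (r : X -> U -> R) (hp : rmdp p)
    (G : graph X) (hG : canonical_graph p G) :
  exists (p0 : forall B : graph X,
                 {x : X | x \in verts B} -> {x : X | x \in verts B} -> R)
         (nu : X -> U -> graph X -> R)
         (rho : X -> U -> R),
    (forall B, block G B ->
       [/\ stochastic (p0 B), irreducible (p0 B), reversible (p0 B) &
           forall i, p0 B i i = 0]) /\
    (forall a u, articulation G a ->
       (forall B, block G B -> a \in verts B -> 0 < nu a u B) /\
       \sum_(B : graph X | block G B && (a \in verts B)) nu a u B = 1) /\
    (forall i u, 0 < rho i u <= 1) /\
    (forall u B i, block G B -> i \in interior G B -> nu i u B = 1) /\
    (forall u,
       (forall B, block G B ->
          forall i j : {x : X | x \in verts B}, j != i ->
          p u (val i) (val j) = rho (val i) u * nu (val i) u B * p0 B i j) /\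
       (forall i, p u i i = 1 - rho i u) /\
       (forall i j, j != i ->
          ~ (exists B, [/\ block G B, i \in verts B & j \in verts B]) ->
          p u i j = 0)).
Proof.
have /card_gt0P[u0 _] : (0 < #|U|)%N by exact: ltnW.
have rho_gt0 u i : 0 < 1 - p u i i := leaving_gt0 hp hG hX u i.
have rho_neq0 u i : 1 - p u i i != 0 by rewrite gt_eqF.
have exit_pos u i B : block G B -> i \in verts B -> 0 < block_exit p u i B.
  exact: (block_exit_gt0 hp hG hX).
exists (block_jump p u0), (fun i u B => block_exit p u i B / (1 - p u i i)),
  (fun i u => 1 - p u i i).
have sum_nu i u : \sum_(B : graph X | block G B && (i \in verts B))
    block_exit p u i B / (1 - p u i i) = 1.
  by rewrite -mulr_suml (sum_block_exit hp hG) divff.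
split=> [B bB|].
  split; [exact (block_jump_stochastic hp hG hX u0 bB) |
          exact (block_jump_irreducible hp hG hX u0 bB) |
          exact (block_jump_reversible hp hG hX u0 bB) |].
  by move=> i; rewrite /block_jump eqxx.
split=> [a u _|].
  by split; [move=> B bB aB; rewrite divr_gt0 ?exit_pos | exact: sum_nu].
split=> [i u|].
  by rewrite rho_gt0 gerBl; have [pu _] := hp; case: (pu u i) => ->.
split=> [u B i bB iB|u].
  rewrite -[RHS](sum_nu i u) (big_pred1 (B : {set X} * {set {set X}})) // => B' /=.
  apply/andP/eqP=> [[bB' iB']|->]; first exact: interior_single_block iB bB' iB'.
  by move: iB; rewrite inE bB => /andP[].
split=> [B bB i j ji|].
  rewrite /block_jump (negbTE ji).
  rewrite -(block_jump_action_indep hp hG hX u u0 bB (valP i) (valP j) ji).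
  have := exit_pos u (val i) B bB (valP i).
  by rewrite lt0r => /andP[exit_neq0 _]; field; rewrite exit_neq0 rho_neq0.
split=> [i|i j ji nB]; first by rewrite subKr.
apply: (nonadj_transition hp hG); first by rewrite eq_sym.
by apply/negP=> ij; apply: nB; apply: adj_common_block; case: hG.
Qed.
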